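(* Let $\mathcal{G}$ be a geometry. Then $\mathcal{G}$ is a finite partial Sherk plane in which some line is incident only with thick points if and only if $\mathcal{G}$ is a finite Bruck net of degree $r$ with $r$ even and $r>2$ (equipped with a suitable perpendicularity relation). More precisely, the following two classes coincide: (1) finite partial Sherk planes in which some line is incident only with thick points; (2) finite Bruck nets of degree $r$ where $r$ is even and $r>2$.
   Context: A geometry consists of a set of points, a set of lines, an incidence relation between points and lines, and a binary relation $\perp$ (perpendicularity) on lines. Two lines intersect if some point is incident with both. A partial Sherk plane is a geometry satisfying: (A* ) two distinct points are incident with at most one line; (B1) if $\ell\perp m$ then $m\perp\ell$; (B2) perpendicular lines intersect in at least one point; (B3) given a point $P$ and a line $\ell$, there is at least one line $m$ with $m$ incident with $P$ and $m\perp\ell$; (B4) given a point $P$ and a line $\ell$ incident with $P$, there is a unique line $m$ incident with $P$ with $m\perp\ell$; (B5) there exist lines $x,y,z$ with $x\perp y$, $x\not\perp z$, $y\not\perp z$, and $x,y,z$ not all incident with a common point. It is finite if it has finitely many points. A point is thick if it is incident with at least three lines. A (Bruck) net is a partial linear space (distinct points lie on at most one common line) satisfying: (N1) for a line $\ell$ and a point $P$ not on $\ell$ there is a unique line through $P$ not intersecting $\ell$; (N2) for every line there are two points not on it; (N3) for every point there are two lines not through it. Lines are parallel if they are equal or do not intersect; this is an equivalence relation whose classes are the parallel classes. In a finite net every point lies on the same number $r$ of lines (the degree), and there are $r$ parallel classes. For a finite net of even degree $r>2$, perpendicularity is given by choosing a fixed-point-free involution $\tau$ on the set of parallel classes and declaring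 $\ell\perp m$ iff $[\ell]^\tau=[m]$, where $[\ell]$ denotes the parallel class of $\ell$. *)

(* Defs.v *)
From mathcomp Require Import all_boot.
From mathcomp Require Import boolp classical_sets functions cardinality.

Set Implicit Arguments.
Unset Strict Implicit.
Unset Printing Implicit Defensive.

Local Open Scope classical_set_scope.
Local Open Scope card_scope.

(* Lines are abstract objects, not point sets: distinct lines may carry the
   same points unless an axiom forbids it. *)
Record incidence_structure := IncidenceStructure {
  point : Type;
  line : Type;
  inc : point -> line -> Prop
}.

Record geometry := Geometry {
  incidence_of :> incidence_structure;
  perp : line incidence_of -> line incidence_of -> Prop
}.

Section Incidence.
Variable S : incidence_structure.
Implicit Types (P Q : point S) (l m n : line S).

Definition intersect l m := exists P, inc P l /\ inc P m.

Definition partial_linear :=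
  forall P Q l m, P <> Q ->
    inc P l -> inc Q l -> inc P m -> inc Q m -> l = m.

Definition finite_points := finite_set [set: point S].

Definition lines_through P : set (line S) := [set l | inc P l].

Definition thick P :=
  exists l m n, [/\ l <> m, l <> n & m <> n] /\ [/\ inc P l, inc P m & inc P n].

Definition bruck_net :=
  [/\ partial_linear,
      forall l P, ~ inc P l -> exists! m, inc P m /\ ~ intersect m l,
      forall l, exists P Q, [/\ P <> Q, ~ inc P l & ~ inc Q l]
    & forall P, exists l m, [/\ l <> m, ~ inc P l & ~ inc P m]].

Definition parallel l m := l = m \/ ~ intersect l m.

Definition parallel_class l : set (line S) := [set m | parallel l m].

Definition parallel_classes : set (set (line S)) := range parallel_class.

(* For a net with at least one point the first clause implies the second. The
   second one is what gives the structure with no points and no lines, which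
   satisfies the net axioms vacuously, the degree 0 and no other degree. *)
Definition has_degree (r : nat) :=
  (forall P, lines_through P #= `I_r) /\ parallel_classes #= `I_r.

Definition finite_net_of_degree (r : nat) :=
  [/\ finite_points, bruck_net & has_degree r].

(* [tau] is only constrained on parallel classes; its values on other sets of
   lines are irrelevant. *)
Definition fpf_involution_on_classes (tau : set (line S) -> set (line S)) :=
  forall C, parallel_classes C ->
    [/\ parallel_classes (tau C), tau (tau C) = C & tau C <> C].

End Incidence.

Section Geometry.
Variable G : geometry.
Implicit Types (P : point G) (l m x y z : line G).

Definition partial_sherk_plane :=
  partial_linear G /\
  [/\ forall l m, perp l m -> perp m l,
      forall l m, perp l m -> intersect l m,
      forall P l, exists m, inc P m /\ perp m l,
      forall P l, inc P l -> exists! m, inc P m /\ perp m l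
    & exists x y z, [/\ perp x y, ~ perp x z, ~ perp y z
        & ~ exists P, [/\ inc P x, inc P y & inc P z]]].

Definition has_thick_line :=
  exists l, forall P, inc P l -> thick P.

Definition net_perpendicularity :=
  exists tau, fpf_involution_on_classes tau /\
    forall l m, perp l m <-> tau (parallel_class l) = parallel_class m.

End Geometry.

Definition finite_sherk_with_thick_line (G : geometry) :=
  [/\ finite_points G, partial_sherk_plane G & has_thick_line G].

(* Main.v *)
Require Import Defs.
From mathcomp Require Import all_boot all_algebra zify.

(* Let [x], [l] be lines of a finite partial Sherk plane that are not
   perpendicular. Sending a perpendicular [m] to [l] to the perpendicular to [x]
   at the point where [m] meets [x] is onto the perpendiculars to [x], so
   comparing sizes both ways it is a bijection. Hence a point from which two
   perpendiculars can be dropped to [l] has all its lines perpendicular to [l]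
   ([l] is then a pole of the point, as in elliptic geometry), and disjoint lines
   have the same perpendiculars. A line with only thick points forces all points
   to be thick. Poles then cannot exist: passing to the perpendiculars of a line,
   a smallest configuration with poles would be a blown-up friendship graph of
   degree at least 4, which the trace argument modulo a prime excludes. Without
   poles perpendiculars are unique, lines with a common perpendicular are
   parallel, and the net axioms follow. *)

Set Implicit Arguments.
Unset Strict Implicit.
Unset Printing Implicit Defensive.

(** * Friendship graphs *)

Section SquareZero.
Local Open Scope ring_scope.
Import GRing.Theory.

(** Factor [A = B *m C] through its rank. Then [B *m (C *m B) *m C = 0], where [B] and [C] cancel,
    and [C *m B] has the trace of [A], in any characteristic. *)
Lemma mxtrace_square_zero (F : fieldType) n (A : 'M[F]_n) :
  A *m A = 0 -> \tr A = 0.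
Proof.
move=> AA0; have defA := mulmx_base A.
have := row_base_free A; have := col_base_full A.
move: (\rank A) (col_base A) (row_base A) defA => r B C defA fullB freeC.
rewrite -defA mxtrace_mulC; suff -> : C *m B = 0 by rewrite mxtrace0.
apply: (row_full_inj fullB); apply: (row_free_inj freeC).
by rewrite mulmx0 mul0mx -[RHS]AA0 -defA !mulmxA.
Qed.

(* Modulo a prime dividing [r - 1] the adjacency matrix [A] satisfies [A^2 = J]
   and [A J = J], so [A - J] squares to zero and [tr A = tr J = 1]; but [tr A = 0]. *)
Lemma friendship_absurd (m r : nat) (e : rel 'I_m) :
  (0 < m)%N -> (2 < r)%N -> symmetric e -> irreflexive e ->
  (forall i, #|[set k | e k i]| = r) ->
  (forall i j, i != j -> #|[set k | e k i && e k j]| = 1%N) -> False.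
Proof.
move=> m_gt0 r_gt2 esym eirr degE comE.
set p := pdiv r.-1.
have p_pr : prime p by apply: pdiv_prime; rewrite -ltnS prednK // (ltn_trans _ r_gt2).
have rE : r%:R = 1 :> 'F_p.
  have [c ->] : exists c, r = (c * p + 1)%N.
    have /dvdnP[c rc] : (p %| r.-1)%N by apply: pdiv_dvd.
    by exists c; rewrite -rc addn1 prednK // (ltn_trans _ r_gt2).
  by rewrite natrD natrM pchar_Fp_0 // mulr0 add0r.
pose A : 'M['F_p]_m := \matrix_(i, j) (e i j)%:R.
pose J : 'M['F_p]_m := const_mx 1.
have AA : A *m A = J.
  apply/matrixP=> i j; rewrite !mxE.
  transitivity ((#|[set k | e k i && e k j]|)%:R : 'F_p).
    rewrite -sum1_card natr_sum [RHS]big_mkcond /=; apply: eq_bigr => k _.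
    by rewrite !mxE inE (esym i k); case: (e k i); case: (e k j); rewrite ?mulr0 ?mul0r ?mulr1.
  have [<-|/comE -> //] := eqVneq i j.
  suff -> : [set k | e k i && e k i] = [set k | e k i] by rewrite degE rE.
  by apply/setP=> k; rewrite !inE andbb.
have AJ : A *m J = J.
  apply/matrixP=> i j; rewrite !mxE -[RHS]rE -(degE i) -sum1_card natr_sum [RHS]big_mkcond /=.
  by apply: eq_bigr => k _; rewrite !mxE mulr1 inE (esym i k); case: (e k i).
have JJ : J *m J = J by rewrite -{1}AA -mulmxA !AJ.
have JA : J *m A = J by rewrite -{1}AA -mulmxA AA AJ.
(* A diagonal entry of [J *m J] is the sum of [m] ones, which is also [\tr J]. *)
have trJ : \tr J = 1.
  have := congr1 (fun M : 'M_m => M (Ordinal m_gt0) (Ordinal m_gt0)) JJ.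
  rewrite !mxE => <-; rewrite /mxtrace; apply: eq_bigr => k _.
  by rewrite !mxE mulr1.
have trA : \tr A = 0 by rewrite /mxtrace big1 // => k _; rewrite mxE eirr.
have : \tr (A - J) = 0.
  apply: mxtrace_square_zero.
  by rewrite mulmxBl !mulmxBr AA AJ JA JJ !subrr.
rewrite raddfB /= trA trJ sub0r => /eqP; rewrite oppr_eq0.
by rewrite oner_eq0.
Qed.
End SquareZero.

(** * Finite partial Sherk planes *)

(** The set splits into pairs [x], [f x]. Applied to a pencil, this makes the degree even. *)
Lemma even_card_fpf (T : finType) (A : {set T}) (f : T -> T) :
  (forall x, x \in A -> [/\ f x \in A, f (f x) = x & f x != x]) -> ~~ odd #|A|.
Proof.
have [n] := ubnP #|A|; elim: n A => // n IHn A ltAn fA.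
have [->|/set0Pn[x xA]] := eqVneq A set0; first by rewrite cards0.
have [fxA ffx fxx] := fA x xA.
rewrite (cardsD1 x) xA (cardsD1 (f x)) !inE fxx fxA /= negbK.
apply: IHn => [|y].
  by move: ltAn; rewrite (cardsD1 x) xA (cardsD1 (f x)) !inE fxx fxA /=; lia.
rewrite !inE => /and3P[yfx yx yA]; have [fyA ffy fyy] := fA y yA.
split=> //; apply/and3P; split=> //.
  by apply: contra_neq yx => fyfx; rewrite -ffy fyfx ffx.
by apply: contra_neq yfx => <-; rewrite ffy.
Qed.

Lemma card_enum_val_set (T : finType) (A : {set T}) (Q : pred T) :
  #|[set k : 'I_#|A| | Q (enum_val k)]| = #|[set x in A | Q x]|.
Proof.
rewrite -(card_imset _ (@enum_val_inj _ (mem A))); apply: eq_card => x.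
rewrite inE; apply/imsetP/andP => [[k]|[xA Qx]].
  by rewrite inE => Qk ->; split=> //; apply: enum_valP.
by exists (enum_rank_in xA x); rewrite ?inE enum_rankK_in.
Qed.

Section FiniteSherk.
Variables (T L : finType) (inc : T -> L -> bool) (perp : rel L).
Hypothesis inc_inj : forall P Q l m, P != Q ->
  inc P l -> inc Q l -> inc P m -> inc Q m -> l = m.
Hypothesis perp_sym : symmetric perp.
Hypothesis perp_irr : irreflexive perp.
Hypothesis perp_meet :
  forall l m, perp l m -> exists2 P, inc P l & inc P m.
Hypothesis perp_ex : forall P l, exists2 m, inc P m & perp m l.
Hypothesis perp_uniq : forall P l m m',
  inc P l -> inc P m -> inc P m' -> perp m l -> perp m' l -> m = m'.

Definition pencil P := [set l | inc P l].
Definition perps l := [set m | perp m l].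
(** The substructures over which poles are excluded by induction; the perpendiculars in [W] to a
    line of [W] form a smaller one. *)
Definition subspace (W : {set L}) :=
  forall P g h, inc P g -> inc P h -> g != h -> g \in W -> h \in W ->
    pencil P \subset W.

Lemma perp_neq l m : perp l m -> l != m.
Proof. by apply: contraTneq => ->; rewrite perp_irr. Qed.

Lemma subspaceT : subspace [set: L].
Proof. by move=> *; apply: subsetT. Qed.

Lemma in_pencil_sub (W : {set L}) P l : pencil P \subset W -> inc P l -> l \in W.
Proof. by move=> /subsetP sPW Pl; apply: sPW; rewrite inE. Qed.

(* For [m] perpendicular to [l], the perpendicular to [x] at the point where [m]
   meets [x] (junk value [m] if there is none); this maps the perpendiculars to
   [l] onto those to [x] when [x] and [l] are not perpendicular. *)
Definition foot_perp (W : {set L}) x m :=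
  odflt m [pick h in W :&: perps x | [exists P, [&& inc P x, inc P h & inc P m]]].

(** The choice is forced: a second common point would give [x = m], which is perpendicular to [l],
    and [x] has only one perpendicular at [P]. *)
Lemma foot_perpE (W : {set L}) x l m h P : x \in W -> l \in W -> ~~ perp x l ->
  h \in W :&: perps x -> inc P x -> inc P h -> inc P m -> perp m l ->
  foot_perp W x m = h.
Proof.
move=> xW lW nxl /setIP[hW]; rewrite inE => hx Px Ph Pm ml.
rewrite /foot_perp; case: pickP => [h'|/(_ h)] /=; last first.
  by rewrite !inE hW hx => /existsP[]; exists P; rewrite Px Ph Pm.
rewrite !inE => /andP[/andP[_ h'x] /existsP[P' /and3P[P'x P'h' P'm]]].
suff eqP' : P' = P by apply: (perp_uniq Px) => //; rewrite -eqP'.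
apply/eqP/negPn/negP => P'P; move: nxl; suff -> : x = m by rewrite ml.
exact: inc_inj P'P _ _ _ _.
Qed.

(** * Counting perpendiculars inside a subspace *)

Section Subspace.
Variable W : {set L}.
Hypothesis subW : subspace W.

Lemma perps_foot_sub x l : x \in W -> l \in W -> ~~ perp x l ->
  W :&: perps x \subset foot_perp W x @: (W :&: perps l).
Proof.
move=> xW lW nxl; apply/subsetP => h hN; have /setIP[hW] := hN.
rewrite inE => hx; have [P Ph Px] := perp_meet hx.
have [m Pm ml] := perp_ex P l.
have mW := in_pencil_sub (subW Ph Px (perp_neq hx) hW xW) Pm.
apply/imsetP; exists m; first by rewrite !inE mW.
by rewrite (foot_perpE xW lW nxl hN Px Ph).
Qed.

Lemma nperp_card x l : x \in W -> l \in W -> ~~ perp x l ->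
  #|W :&: perps x| = #|W :&: perps l|.
Proof.
have le x' l' : x' \in W -> l' \in W -> ~~ perp x' l' ->
    #|W :&: perps x'| <= #|W :&: perps l'|.
  move=> xW lW nxl; apply: leq_trans (subset_leq_card (perps_foot_sub xW lW nxl)) _.
  exact: leq_imset_card.
move=> xW lW nxl; apply/eqP; rewrite eqn_leq !le // perp_sym.
exact: nxl.
Qed.

Lemma perps_foot_eq x l : x \in W -> l \in W -> ~~ perp x l ->
  foot_perp W x @: (W :&: perps l) = W :&: perps x.
Proof.
move=> xW lW nxl; apply/esym/eqP; rewrite eqEcard perps_foot_sub //=.
by rewrite (nperp_card xW lW nxl) leq_imset_card.
Qed.

(** Both [m] and [m'] are sent to the perpendicular to [x] at [P], and a surjection between finite
    sets of equal size is injective. *)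
Lemma nperp_uniq P x l m m' : pencil P \subset W -> inc P x -> l \in W ->
  ~~ perp x l -> inc P m -> inc P m' -> perp m l -> perp m' l -> m = m'.
Proof.
move=> PW Px lW nxl Pm Pm' ml m'l; have xW := in_pencil_sub PW Px.
have [h Ph hx] := perp_ex P x.
have hN : h \in W :&: perps x by rewrite !inE hx (in_pencil_sub PW Ph).
have /imset_injP inj : #|foot_perp W x @: (W :&: perps l)| == #|W :&: perps l|.
  by rewrite perps_foot_eq // (nperp_card xW lW nxl).
apply: inj; rewrite ?inE ?ml ?m'l ?(in_pencil_sub PW Pm) ?(in_pencil_sub PW Pm') //.
by rewrite (foot_perpE xW lW nxl hN Px Ph Pm) // (foot_perpE xW lW nxl hN Px Ph Pm').
Qed.

(** If [m] missed [x], [foot_perp] would return its default [m]; but its values here are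
    perpendicular to [x], hence meet [x]. *)
Lemma nperp_meet x l m : x \in W -> l \in W -> m \in W -> ~~ perp x l ->
  perp m l -> exists2 P, inc P m & inc P x.
Proof.
move=> xW lW mW nxl ml.
have : foot_perp W x m \in W :&: perps x.
  by rewrite -(perps_foot_eq xW lW nxl) imset_f // !inE mW.
rewrite /foot_perp; case: pickP => [h|_] /=; last first.
  by rewrite !inE => /andP[_ /perp_meet].
by move=> /andP[_ /existsP[P /and3P[Px _ Pm]]]; exists P.
Qed.

Lemma two_perps_pole P l m m' : pencil P \subset W -> l \in W ->
  inc P m -> inc P m' -> perp m l -> perp m' l -> m != m' ->
  pencil P \subset perps l.
Proof.
move=> PW lW Pm Pm' ml m'l /negP mm'; apply/subsetP => x; rewrite !inE => Px.
by apply/negPn/negP => nxl; apply: mm'; rewrite (nperp_uniq PW Px lW nxl Pm Pm').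
Qed.

Lemma disjoint_perps g g' x : g \in W -> g' \in W -> x \in W -> g != g' ->
  ~ (exists2 P, inc P g & inc P g') -> perp x g -> perp x g'.
Proof.
move=> gW g'W xW gg' dis xg; apply/negPn/negP => nxg'; apply: dis.
by apply: (@nperp_meet _ x) => //; rewrite perp_sym.
Qed.

Lemma perps_neq_meet g g' : g \in W -> g' \in W ->
  W :&: perps g != W :&: perps g' ->
  g != g' /\ exists P, [/\ inc P g, inc P g' & pencil P \subset W].
Proof.
move=> gW g'W neqN; have gg' : g != g' by apply: contraNneq neqN => ->.
split=> //; case: (boolP [exists P, inc P g && inc P g']).
  by move=> /existsP[P /andP[Pg Pg']]; exists P; split; rewrite // (subW Pg Pg').
move=> nmeet; case/negP: neqN; apply/eqP/setP => x; rewrite !inE.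
have dis : ~ (exists2 P, inc P g & inc P g').
  by case=> P Pg Pg'; case/existsP: nmeet; exists P; rewrite Pg.
case: (boolP (x \in W)) => //= xW; apply/idP/idP.
  exact: disjoint_perps.
by apply: disjoint_perps; rewrite 1?eq_sym // => -[P Pg' Pg]; apply: dis; exists P.
Qed.

End Subspace.

(** * Thickness spreads from one line to all points *)

Lemma third_line P x y : 2 < #|pencil P| ->
  exists f, [/\ inc P f, f != x & f != y].
Proof.
move=> thickP; have : 0 < #|pencil P :\ x :\ y|.
  have := cardsD1 x (pencil P); have := cardsD1 y (pencil P :\ x).
  by case: (x \in _); case: (y \in _); lia.
by case/card_gt0P => f; rewrite !inE => /and3P[fy fx Pf]; exists f.
Qed.

(** Every line is perpendicular to [x] or [y], since one of these is its perpendicular from [P]. A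
    third line through [Q] thus gives [x] or [y] a second perpendicular from [Q], hence the whole
    pencil. *)
Lemma thin_common_perp P Q x y : pencil P = [set x; y] -> 2 < #|pencil Q| ->
  exists h, [/\ inc Q h, perp h x & perp h y].
Proof.
move=> defP thickQ.
have cov h : perp h x || perp h y.
  have [g Pg gh] := perp_ex P h; have : g \in pencil P by rewrite inE.
  by rewrite perp_sym in gh; rewrite defP !inE => /orP[] /eqP <-; rewrite gh ?orbT.
have full z a b : inc Q a -> inc Q b -> a != b -> perp a z -> perp b z ->
    forall h, inc Q h -> perp h z.
  move=> Qa Qb ab az bz h Qh.
  have /subsetP/(_ h) : pencil Q \subset perps z.
    by apply: (two_perps_pole subspaceT (subsetT _) _ Qa Qb az bz ab).
  by rewrite !inE; apply.
have [hx Qhx hxx] := perp_ex Q x; have [hy Qhy hyy] := perp_ex Q y.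
have [f [Qf fhx fhy]] := third_line hx hy thickQ.
have /orP[fx|fy] := cov f.
  by exists hy; split; rewrite // (full x f hx).
by exists hx; split; rewrite // (full y f hy).
Qed.

(** Otherwise [y] meets [l] at some [Q]. Since [l] is not perpendicular to [x], only one
    perpendicular to [x] passes through [Q], so [y] is the common perpendicular to [x] and [y], and
    is perpendicular to itself. *)
Lemma thick_line_perp P x y l : pencil P = [set x; y] -> perp y x ->
  (forall Q, inc Q l -> 2 < #|pencil Q|) -> perp l x.
Proof.
move=> defP yx thickl; apply/negPn/negP => nlx.
have [Q Qy Ql] := nperp_meet subspaceT (in_setT l) (in_setT x) (in_setT y) nlx yx.
have [h [Qh hx hy]] := thin_common_perp defP (thickl Q Ql).
have := nperp_uniq subspaceT (subsetT _) Ql (in_setT x) nlx Qh Qy hx yx.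
by move=> hE; rewrite hE perp_irr in hy.
Qed.

(** If [x] carries a thin point, [l0] is perpendicular to [x] at some [Q]. A third line [f] through
    [Q] is perpendicular to [x] as well if all its points are thick; if not, [l0] is perpendicular
    to [f] too. Both contradict uniqueness of perpendiculars at [Q]. *)
Lemma all_points_thick l0 : (forall Q, inc Q l0 -> 2 < #|pencil Q|) ->
  forall P, 2 < #|pencil P|.
Proof.
move=> thick0 P; rewrite ltnNge; apply/negP => thinP.
have thinE R x : #|pencil R| <= 2 -> inc R x ->
    exists2 y, perp y x & pencil R = [set x; y].
  move=> thinR Rx; have [y Ry yx] := perp_ex R x; exists y => //.
  apply/esym/eqP; rewrite eqEcard cards2 eq_sym (perp_neq yx) thinR andbT.
  by apply/subsetP => z; rewrite !inE => /orP[] /eqP ->.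
have [x Px _] := perp_ex P l0; have [y yx defP] := thinE P x thinP Px.
have l0x := thick_line_perp defP yx thick0.
have [Q Ql0 Qx] := perp_meet l0x.
have [f [Qf fx fl0]] := third_line x l0 (thick0 Q Ql0).
suff thickf R : inc R f -> 2 < #|pencil R|.
  have fx' := thick_line_perp defP yx thickf.
  by move/eqP: fl0; apply; apply: (perp_uniq Qx).
move=> Rf; rewrite ltnNge; apply/negP => thinR.
have [z zf defR] := thinE R f thinR Rf.
have l0f := thick_line_perp defR zf thick0.
by move/eqP: fx; apply; apply: (perp_uniq Ql0); rewrite // perp_sym.
Qed.

(** * Excluding poles *)

Section AllThick.
Hypothesis thickT : forall P, 2 < #|pencil P|.

(** Perpendicular lines are compared through a third line at their common point, which by uniqueness
    is perpendicular to neither. *)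
Lemma card_perps W x y : subspace W -> x \in W -> y \in W ->
  #|W :&: perps x| = #|W :&: perps y|.
Proof.
move=> subW xW yW; case: (boolP (perp x y)) => [xy|]; last exact: nperp_card.
have [P Px Py] := perp_meet xy; have [f [Pf fx fy]] := third_line x y (thickT P).
have fW : f \in W by apply: in_pencil_sub Pf; apply: (subW P x y); rewrite ?perp_neq.
transitivity #|W :&: perps f|; apply: nperp_card => //; apply/negP => p.
  move/eqP: fy; apply; apply: (perp_uniq Px) => //; first by rewrite perp_sym.
  by rewrite perp_sym.
by move/eqP: fx; apply; apply: (perp_uniq Py).
Qed.

Definition poles_of (W : {set L}) P := [set h in W | pencil P \subset perps h].

Lemma perps_sub (W : {set L}) h : subspace W -> h \in W ->
  subspace (W :&: perps h).
Proof.
move=> subW hW P g g' Pg Pg' gg'; rewrite !inE => /andP[gW gh] /andP[g'W g'h].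
have PW := subW _ _ _ Pg Pg' gg' gW g'W.
by rewrite subsetI PW (two_perps_pole subW PW hW Pg Pg').
Qed.

Lemma common_perps (W : {set L}) P g g' : subspace W -> pencil P \subset W ->
  inc P g -> inc P g' -> g != g' ->
  (W :&: perps g) :&: perps g' = poles_of W P.
Proof.
move=> subW PW Pg Pg' gg'; apply/setP => h; rewrite !inE -andbA.
case: (boolP (h \in W)) => //= hW; apply/andP/idP => [[hg hg']|/subsetP Ph].
  by apply: (two_perps_pole subW PW hW Pg Pg'); rewrite // perp_sym.
by split; rewrite perp_sym; have := Ph _; [move/(_ g)|move/(_ g')]; rewrite !inE; apply.
Qed.

(* Counts the pairs of a line through [P] and a line of [W] perpendicular to it;
   a pole of [P] is counted [#|pencil P|] times, any other line once. *)
Lemma pencil_count (W : {set L}) P : subspace W -> pencil P \subset W ->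
  \sum_(g in pencil P) #|W :&: perps g| + #|poles_of W P| =
  #|W| + #|poles_of W P| * #|pencil P|.
Proof.
move=> subW PW.
have -> : \sum_(g in pencil P) #|W :&: perps g| =
    \sum_(l in W) #|pencil P :&: perps l|.
  under eq_bigr do rewrite -sum1_card.
  under [RHS]eq_bigr do rewrite -sum1_card.
  rewrite (exchange_big_dep (fun l => l \in W)) /=; last by move=> g l _ /setIP[].
  apply: eq_bigr => l lW; apply: eq_bigl => g.
  by rewrite !inE lW perp_sym.
rewrite (bigID (fun l => l \in poles_of W P)) /=.
have -> : \sum_(l in W | l \in poles_of W P) #|pencil P :&: perps l| =
    #|poles_of W P| * #|pencil P|.
  rewrite -sum_nat_const; apply: eq_big => [l|l]; rewrite !inE.
    by case: (l \in W).
  by move=> /andP[_ /andP[_ /setIidPl ->]].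
have -> : \sum_(l in W | l \notin poles_of W P) #|pencil P :&: perps l| =
    #|W :\: poles_of W P|.
  rewrite -sum1_card; apply: eq_big => [l|l]; first by rewrite !inE andbC.
  rewrite !inE => /andP[lW]; rewrite lW /= => npole.
  have [g Pg gl] := perp_ex P l; rewrite (_ : _ :&: _ = [set g]) ?cards1 //.
  apply/setP => m; rewrite !inE; apply/andP/eqP => [[Pm ml]|-> //].
  apply/eqP/negPn/negP => mg; case/negP: npole.
  exact: (two_perps_pole subW PW lW Pm Pg).
have : poles_of W P \subset W by apply/subsetP => h; rewrite inE => /andP[].
by move=> /setIidPr pW; have := cardsID (poles_of W P) W; rewrite pW; lia.
Qed.

(* By induction the perpendiculars to each line of [W] form a subspace without
   poles. This makes the number of poles of a point of [W] a constant [mu], the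
   number of perpendiculars to a line [r * mu] with [r] the common size of the
   pencils, and [mu] the size of a parallel class; perpendicularity of parallel
   classes is then a friendship graph. *)
Lemma no_pole W P : subspace W -> pencil P \subset W -> poles_of W P = set0.
Proof.
have [n] := ubnP #|W|; elim: n W P => // n IHn W P0 ltWn subW P0W.
apply/eqP/negPn/negP => /set0Pn[h0 h0P0].
have h0W : h0 \in W by move: h0P0; rewrite inE => /andP[].
pose N g := W :&: perps g; pose s Q := #|poles_of W Q|.
have degN x y : x \in W -> y \in W -> #|N x| = #|N y| by apply: card_perps.
have IHN h P : h \in W -> pencil P \subset N h -> poles_of (N h) P = set0.
  move=> hW; apply: IHn; last exact: perps_sub.
  rewrite -ltnS (leq_trans _ ltWn) // ltnS proper_card //; apply/properP.
  by split; [apply: subsetIl | exists h; rewrite // !inE perp_irr andbF].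
have sE Q g h : inc Q g -> inc Q h -> g != h -> pencil Q \subset W ->
    #|N g :&: perps h| = s Q.
  by move=> Qg Qh gh QW; rewrite (common_perps subW QW Qg Qh gh).
(* [s Q] counts the lines of [N l] perpendicular to [x], the perpendicular to [l] at [Q];
   [card_perps] applies in the subspace [N l]. *)
have s_line l Q Q' : inc Q l -> inc Q' l ->
    pencil Q \subset W -> pencil Q' \subset W -> s Q = s Q'.
  move=> Ql Q'l QW Q'W; have lW := in_pencil_sub QW Ql.
  have [x Qx xl] := perp_ex Q l; have [x' Q'x' x'l] := perp_ex Q' l.
  rewrite -(sE _ l x) // 1?eq_sym ?perp_neq // -(sE _ l x') // 1?eq_sym ?perp_neq //.
  apply: card_perps; first exact: perps_sub.
    by rewrite !inE xl (in_pencil_sub QW Qx).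
  by rewrite !inE x'l (in_pencil_sub Q'W Q'x').
pose mu := s P0.
have sP Q : pencil Q \subset W -> s Q = mu.
  move=> QW; have [x P0x _] := perp_ex P0 h0; have [m Qm mx] := perp_ex Q x.
  have [R Rm Rx] := perp_meet mx.
  have RW : pencil R \subset W.
    apply: (subW R m x); rewrite ?perp_neq //.
      exact: in_pencil_sub QW Qm.
    exact: in_pencil_sub P0W P0x.
  by rewrite (s_line m Q R) // (s_line x R P0).
have mu_gt0 : 0 < mu by apply/card_gt0P; exists h0.
(* Count in [N h] for a pole [h] of [Q]: there [Q] has no poles, so each line of [N h] is
   perpendicular to exactly one line [x] through [Q], and [x] and [h] have [mu] common
   perpendiculars. *)
have degE Q g : pencil Q \subset W -> g \in W -> #|N g| = #|pencil Q| * mu.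
  move=> QW gW; have : 0 < s Q by rewrite sP.
  case/card_gt0P => h; rewrite inE => /andP[hW Qh].
  have QN : pencil Q \subset N h by rewrite subsetI QW.
  have := pencil_count (perps_sub subW hW) QN; rewrite IHN // cards0 !addn0.
  rewrite (degN g h) // => <-; rewrite -sum_nat_const; apply: eq_bigr => x.
  move=> xQ; have /setIP[xW] := subsetP QN x xQ; rewrite inE => xh.
  have [R Rx Rh] := perp_meet xh.
  have RW := subW R x h Rx Rh (perp_neq xh) xW hW.
  by rewrite (sE R) ?sP // eq_sym perp_neq.
pose r := #|pencil P0|.
have degr g : g \in W -> #|N g| = r * mu by apply: degE.
have cardW : r * (r * mu) + mu = #|W| + mu * r.
  rewrite -(pencil_count subW P0W); congr (_ + _).
  rewrite -sum_nat_const; apply: eq_bigr => g; rewrite inE => P0g.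
  by rewrite degr // (in_pencil_sub P0W P0g).
have comN g g' : g \in W -> g' \in W -> N g != N g' -> #|N g :&: perps g'| = mu.
  move=> gW g'W neqN.
  have [gg' [P [Pg Pg' PW]]] := perps_neq_meet subW gW g'W neqN.
  by rewrite (sE P) ?sP.
(* Double counting of the pairs [g'], [h] with [h] perpendicular to [g] and [g']: a [g'] in [C]
   contributes [r * mu], any other [mu], and the total is [(r * mu) ^ 2]. With [cardW] this gives
   [(r - 1) * #|C| = (r - 1) * mu]. *)
have class_card g : g \in W -> #|[set g' in W | N g' == N g]| = mu.
  move=> gW; set C := [set g' in W | _].
  have : \sum_(g' in W) #|N g :&: perps g'| = r * mu * (r * mu).
    under eq_bigr do rewrite -sum1_card.
    rewrite (exchange_big_dep (fun h => h \in N g)) /=; last by move=> ? ? _ /setIP[].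
    rewrite -{1}(degr g gW) -sum_nat_const; apply: eq_bigr => h hN.
    have hW : h \in W by case/setIP: hN.
    rewrite -(degr h hW) -sum1_card; apply: eq_bigl => x.
    by rewrite inE hN !inE perp_sym.
  have CW : C \subset W by apply/subsetP => x; rewrite inE => /andP[].
  rewrite (bigID (fun g' => g' \in C)) /=.
  have -> : \sum_(g' in W | g' \in C) #|N g :&: perps g'| = #|C| * (r * mu).
    rewrite -sum_nat_const; apply: eq_big => [x|x]; rewrite !inE.
      by case: (x \in W).
    move=> /andP[_ /andP[xW /eqP eqN]]; rewrite -eqN -(degr x xW).
    by rewrite /N -setIA setIid.
  have -> : \sum_(g' in W | g' \notin C) #|N g :&: perps g'| = #|W :\: C| * mu.
    rewrite -sum_nat_const; apply: eq_big => [x|x]; first by rewrite !inE andbC.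
    rewrite !inE => /andP[xW]; rewrite xW eq_sym /= => neqN.
    exact: comN.
  have := cardsID C W; have /setIidPr -> := CW.
  have := thickT P0; rewrite -/r.
  move: #|C| #|W :\: C| #|W| cardW mu_gt0 => q d b; case: (r) => [|[|k]] //.
  move=> defb mu0 _ defd.
  move=> eq2; have /eqP : (q * k.+2 + d) * mu = (k.+2 * mu * k.+2) * mu by nia.
  rewrite eqn_pmul2r // => /eqP eqq.
  have /eqP : k.+1 * q = k.+1 * mu by nia.
  by rewrite eqn_pmul2l // => /eqP.
(* [rep] sees a line only through its perpendiculars, so it picks one line per class; on [N g] with
   [g] in [W] the default is never reached. *)
pose rep X := odflt h0 [pick g' in W | N g' == X].
have repP g : g \in W -> rep (N g) \in W /\ N (rep (N g)) = N g.
  move=> gW; rewrite /rep; case: pickP => [x /andP[xW /eqP] //|/(_ g)] /=.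
  by rewrite gW eqxx.
pose R := [set rep (N g) | g in W].
have RP c : c \in R -> c \in W /\ rep (N c) = c.
  by case/imsetP=> g gW ->; have [? ->] := repP g gW.
have card_rep (S : {set L}) : S \subset W ->
    (forall g g', g \in S -> g' \in W -> N g = N g' -> g' \in S) ->
    #|S| = #|R :&: S| * mu.
  move=> /subsetP SW closedS; rewrite -sum_nat_const -sum1_card.
  rewrite (partition_big (fun g => rep (N g)) (fun c => c \in R :&: S)) /=.
    apply: eq_bigr => c /setIP[cR cS]; have [cW repc] := RP c cR.
    rewrite sum1_card -(class_card c cW); apply: eq_card => g; rewrite !inE.
    apply/andP/andP => [[gS /eqP gc]|[gW /eqP gc]].
      by split; rewrite ?SW // -gc (repP g (SW g gS)).2.
    by rewrite gc repc eqxx (closedS c).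
  move=> g gS; have [repW repN] := repP g (SW g gS).
  by rewrite inE (closedS g) // andbT; apply: imset_f; apply: SW.
have closedN x g g' : x \in W -> g \in N x -> g' \in W -> N g = N g' -> g' \in N x.
  rewrite !inE => xW /andP[gW gx] -> /setP/(_ x); rewrite !inE xW /=.
  by rewrite perp_sym gx perp_sym.
pose e := fun i j : 'I_#|R| => perp (enum_val i) (enum_val j).
have inR (i : 'I_#|R|) : enum_val i \in R by apply: enum_valP.
(* After division by the class size [mu], the [r * mu] perpendiculars become [r] neighbours and the
   [mu] common perpendiculars one common neighbour. *)
apply: (@friendship_absurd #|R| r e).
- by apply/card_gt0P; exists (rep (N h0)); apply: imset_f.
- exact: thickT.
- by move=> i j; rewrite /e perp_sym.
- by move=> i; rewrite /e perp_irr.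
- move=> i; have [iW _] := RP _ (inR i).
  rewrite /e (card_enum_val_set R (fun x => perp x (enum_val i))).
  apply/eqP; rewrite -(eqn_pmul2r mu_gt0) -(degr (enum_val i)) //; apply/eqP.
  rewrite (card_rep (N (enum_val i))) ?subsetIl //; last by move=> g g'; apply: closedN.
  congr (_ * _); apply: eq_card => x; rewrite !inE.
  by case: (boolP (x \in R)) => //= /RP[->].
move=> i j ij; have [iW repi] := RP _ (inR i); have [jW repj] := RP _ (inR j).
rewrite /e (card_enum_val_set R (fun x => perp x (enum_val i) && perp x (enum_val j))).
apply/eqP; rewrite -(eqn_pmul2r mu_gt0) mul1n.
have neqN : N (enum_val i) != N (enum_val j).
  by apply: contra_neq ij => eqN; apply: enum_val_inj; rewrite -repi eqN repj.
rewrite -[X in _ == X](comN _ _ iW jW neqN) (card_rep (N _ :&: _)).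
- apply/eqP; congr (_ * _); apply: eq_card => x; rewrite !inE.
  by case: (boolP (x \in R)) => //= /RP[->].
- by rewrite -setIA subsetIl.
move=> g g' /setIP[gi gj] g'W eqN; rewrite inE (closedN _ g) //=.
suff /setIP[] : g' \in N (enum_val j) by [].
by apply: (closedN _ g) => //; rewrite inE gj andbT; case/setIP: gi.
Qed.

Lemma perp_unique P l m m' : inc P m -> inc P m' -> perp m l -> perp m' l -> m = m'.
Proof.
move=> Pm Pm' ml m'l; apply/eqP/negPn/negP => mm'.
have PT : pencil P \subset [set: L] by apply: subsetT.
have := two_perps_pole subspaceT PT (in_setT l) Pm Pm' ml m'l mm'.
move=> pole; have := in_set0 l; rewrite -(no_pole subspaceT PT).
by rewrite inE in_setT pole.
Qed.

End AllThick.
End FiniteSherk.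

From mathcomp Require Import boolp classical_sets functions cardinality.

(** * From geometries to finite types *)

Lemma injective_ordinal_bij (X : Type) (F : finType) (c : X -> F) :
  injective c ->
  exists n (f : X -> 'I_n) (g : 'I_n -> X), cancel f g /\ cancel g f.
Proof.
move=> c_inj; pose A := [set y : F | `[< exists x, c x = y >]].
have cA x : c x \in A by rewrite inE; apply/asboolP; exists x.
have /choice[g gE] (i : 'I_#|A|) : exists x, c x = enum_val i.
  by have := enum_valP i; rewrite inE => /asboolP.
exists #|A|, (fun x => enum_rank_in (cA x) (c x)), g; split.
  by move=> x; apply: c_inj; rewrite gE enum_rankK_in.
by move=> i; apply: enum_val_inj; rewrite enum_rankK_in ?gE ?enum_valP.
Qed.

Lemma card_eq_ordinal_preimage (X : Type) n (f : X -> 'I_n) (g : 'I_n -> X)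
    (A : set X) : cancel f g -> cancel g f ->
  (A #= `I_#|[set i | `[< A (g i) >]]|)%card.
Proof.
move=> fK gK; set B := [set i | _].
have inB x : A x -> f x \in B by move=> Ax; rewrite inE fK; apply/asboolP.
apply/card_set_bijP; exists (fun x => index (f x) (enum B)); split.
- by move=> x Ax /=; rewrite cardE index_mem mem_enum inB.
- move=> x y /set_mem Ax /set_mem Ay eqi; apply: (can_inj fK).
  by apply: (index_inj (f x) _ _ eqi); rewrite mem_enum inB.
move=> k /= ltk; have lts : k < size (enum B) by rewrite -cardE.
case defn : n => [|n'] in f g fK gK B inB ltk lts *.
  by move: ltk; rewrite (eq_card0 (A := B)) // => -[].
exists (g (nth ord0 (enum B) k)); last by rewrite gK index_uniq ?enum_uniq.
by have := mem_nth ord0 lts; rewrite mem_enum inE => /asboolP.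
Qed.

(** The codomain has one extra element so that [inord] makes [c] total on [X], even for [n = 0]. *)
Lemma card_eq_ordinal_inj (X : Type) (A : set X) n :
  (A #= `I_n)%card ->
  exists c : X -> 'I_n.+1, forall x y, A x -> A y -> c x = c y -> x = y.
Proof.
move=> /card_set_bijP[f [fI f_inj _]]; exists (fun x => inord (f x)).
have fI' x : A x -> f x < n.+1 by move=> Ax; apply: leqW; apply: fI.
move=> x y Ax Ay /(congr1 (@nat_of_ord _)); rewrite !inordK ?fI' //.
by apply: f_inj; apply/mem_set.
Qed.

(** * Elementary consequences of the Sherk axioms *)

Section SherkPlane.
Variable G : geometry.
Hypothesis sherkG : partial_sherk_plane G.

Local Notation perp := (@perp G).

Lemma sherk_partial_linear : partial_linear G. Proof. by case: sherkG. Qed.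

Lemma sherk_perp_sym (l m : line G) : perp l m -> perp m l.
Proof. by case: sherkG => _ [+ _ _ _ _]; apply. Qed.

Lemma sherk_perp_meet (l m : line G) : perp l m -> intersect l m.
Proof. by case: sherkG => _ [_ + _ _ _]; apply. Qed.

Lemma sherk_perp_ex P (l : line G) : exists m, inc P m /\ perp m l.
Proof. by case: sherkG => _ [_ _ + _ _]; apply. Qed.

Lemma sherk_perp_uniq P (l m m' : line G) :
  inc P l -> inc P m -> inc P m' -> perp m l -> perp m' l -> m = m'.
Proof.
case: sherkG => _ [_ _ _ uniqP _] Pl Pm Pm' ml m'l.
by have [n [_ nE]] := uniqP P l Pl; rewrite -(nE m) // -(nE m').
Qed.

Lemma sherk_point : exists P : Defs.point G, True.
Proof. by case: sherkG => _ [_ meet _ _ [x [y [z [/meet[P _] _ _ _]]]]]; exists P. Qed.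

Lemma line_has_point (l : line G) : exists P, inc P l.
Proof.
have [P _] := sherk_point; have [m [_ /sherk_perp_meet[Q [_ Ql]]]] := sherk_perp_ex P l.
by exists Q.
Qed.

Lemma other_point (P : Defs.point G) : exists Q, Q <> P.
Proof.
apply: contrapT => /forallNP allP.
have incP l : inc P l.
  have [Q Ql] := line_has_point l.
  by have /contrapT <- := allP Q.
case: sherkG => _ [_ _ _ _ [x [y [z [_ _ _]]]]]; apply.
by exists P.
Qed.

(** If [R] were the only point of [m], all perpendiculars to [m] would pass through [R] and be one
    line [n] containing every point. Any other line then has a single point and is perpendicular to
    [n], against the axiom on [x], [y], [z]. *)
Lemma line_has_two_points P (l : line G) : inc P l -> exists Q, Q <> P /\ inc Q l.
Proof.
suff main (m : line G) R : inc R m -> ~ (forall Q, inc Q m -> Q = R).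
  move=> Pl; apply: contrapT => /forallNP no. apply: (main l P Pl) => Q Ql.
  by apply: contrapT => QP; apply: (no Q).
move=> {P l} Rm onlyR.
have universal (k : line G) S : inc S k -> (forall Q, inc Q k -> Q = S) ->
    exists n, perp n k /\ forall Q, inc Q n.
  move=> Sk onlyS; have [n [Sn nk]] := sherk_perp_ex S k; exists n; split=> // Q.
  have [n' [Qn' n'k]] := sherk_perp_ex Q k.
  have [U [Un' /onlyS US]] := sherk_perp_meet n'k; rewrite US in Un'.
  by rewrite (sherk_perp_uniq Sk Sn Un' nk n'k).
have [n [nm alln]] := universal m R Rm onlyR.
have uniq_full (n' : line G) : (forall Q, inc Q n') -> n' = n.
  move=> alln'; have [Q QR] := other_point R.
  exact: (sherk_partial_linear QR).
have perp_n k : k <> n -> perp k n.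
  move=> kn; have [S Sk] := line_has_point k.
  have [|n' [n'k /uniq_full eqn']] := universal k S Sk.
    move=> Q Qk; apply: contrapT => QS; apply: kn.
    exact: (sherk_partial_linear QS).
  by rewrite -eqn'; apply: sherk_perp_sym.
case: sherkG => _ [_ _ _ _ [x [y [z [xy xz yz]]]]]; apply.
(* If [z = n], then [x] and [y] are both [n]. Otherwise neither is, and where they meet [y] and [n]
   are two perpendiculars to [x]. *)
have [S Sx] := line_has_point x; have [zn|zn] := pselect (z = n).
  have -> : x = n by apply: contrapT => /perp_n; rewrite -zn.
  have -> : y = n by apply: contrapT => /perp_n; rewrite -zn.
  by rewrite zn; exists S; split.
have xn : x <> n by move=> xn; apply: xz; rewrite xn; apply/sherk_perp_sym/perp_n.
have yn : y <> n by move=> yn; apply: yz; rewrite yn; apply/sherk_perp_sym/perp_n.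
have [U [Ux Uy]] := sherk_perp_meet xy; case: yn.
apply: (@sherk_perp_uniq U x) => //; first exact: sherk_perp_sym.
by apply/sherk_perp_sym/perp_n.
Qed.

(** Where a perpendicular to [l] meets [l], it would coincide with [l]; so [l] would contain all
    points and be the only line. *)
Lemma sherk_perp_irr (l : line G) : ~ perp l l.
Proof.
move=> ll; have alll Q : inc Q l.
  have [m [Qm ml]] := sherk_perp_ex Q l; have [R [Rm Rl]] := sherk_perp_meet ml.
  by rewrite (sherk_perp_uniq Rl Rl Rm ll ml).
have lE m : m = l.
  have [P Pm] := line_has_point m; have [Q [QP Qm]] := line_has_two_points Pm.
  exact: (sherk_partial_linear QP).
case: sherkG => _ [_ _ _ _ [x [y [z [xy xz _ _]]]]]; apply: xz.
by rewrite (lE z) -(lE y).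
Qed.

Section Finite.
Hypothesis finG : finite_points G.

(** A line is determined by two chosen points on it, so lines embed into pairs of points. *)
Lemma sherk_finite_bij :
  (exists n (f : Defs.point G -> 'I_n) g, cancel f g /\ cancel g f) /\
  (exists n (f : line G -> 'I_n) g, cancel f g /\ cancel g f).
Proof.
have [n /card_eq_ordinal_inj[c c_inj]] := finG.
have cI : injective c by move=> x y; apply: c_inj.
split; first exact: (injective_ordinal_bij cI).
have /choice[p pE] (l : line G) : exists PQ, [/\ PQ.2 <> PQ.1, inc PQ.1 l & inc PQ.2 l].
  have [P Pl] := line_has_point l; have [Q [QP Ql]] := line_has_two_points Pl.
  by exists (P, Q).
apply: (@injective_ordinal_bij _ _ (fun l => (c (p l).1, c (p l).2))).
move=> l m [/cI eq1 /cI eq2]; have [neq Pl Ql] := pE l; have [_ Pm Qm] := pE m.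
by apply: (sherk_partial_linear neq); rewrite // ?eq1 ?eq2.
Qed.

Hypothesis thickG : has_thick_line G.

Lemma sherk_structure :
  [/\ forall P (l m m' : line G),
        inc P m -> inc P m' -> perp m l -> perp m' l -> m = m',
      forall (g g' x : line G),
        g <> g' -> ~ intersect g g' -> perp x g -> perp x g'
    & forall P : Defs.point G, exists r, [/\ ~~ odd r, 2 < r & (lines_through P #= `I_r)%card]].
Proof.
have [[a [fp [gp [fpK gpK]]]] [b [fl [gl [flK glK]]]]] := sherk_finite_bij.
pose inc' (P : 'I_a) (l : 'I_b) := `[< inc (gp P) (gl l) >].
pose perp' (l m : 'I_b) := `[< perp (gl l) (gl m) >].
have inj' P Q l m : P != Q -> inc' P l -> inc' Q l -> inc' P m -> inc' Q m -> l = m.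
  move=> /eqP PQ /asboolP Pl /asboolP Ql /asboolP Pm /asboolP Qm.
  apply: (can_inj glK); apply: (sherk_partial_linear _ Pl Ql Pm Qm).
  by move/(can_inj gpK).
have sym' : symmetric perp'.
  by move=> l m; apply/asboolP/asboolP; apply: sherk_perp_sym.
have irr' : irreflexive perp' by move=> l; apply/asboolP/sherk_perp_irr.
have meet' l m : perp' l m -> exists2 P, inc' P l & inc' P m.
  move=> /asboolP/sherk_perp_meet[P [Pl Pm]].
  by exists (fp P); rewrite /inc' fpK; apply/asboolP.
have ex' P l : exists2 m, inc' P m & perp' m l.
  have [m [Pm ml]] := sherk_perp_ex (gp P) (gl l).
  by exists (fl m); rewrite /inc' /perp' flK; apply/asboolP.
have uniq' P l m m' : inc' P l -> inc' P m -> inc' P m' ->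
    perp' m l -> perp' m' l -> m = m'.
  move=> /asboolP Pl /asboolP Pm /asboolP Pm' /asboolP ml /asboolP m'l.
  by apply: (can_inj glK); apply: sherk_perp_uniq Pl Pm Pm' ml m'l.
have [l0 thick0] := thickG.
have thickT : forall P, 2 < #|pencil inc' P|.
  apply: (all_points_thick inj' sym' irr' meet' ex' uniq' (l0 := fl l0)) => Q.
  move=> /asboolP; rewrite flK => /thick0[l [m [n [[lm ln mn] [Ql Qm Qn]]]]].
  have neq x y : x <> y -> (fl x == fl y) = false.
    by move=> xy; apply/eqP => /(can_inj flK).
  apply: (@leq_trans #|[set fl l; fl m; fl n]|).
    rewrite -finset.setUA cardsU1 cards2 !inE.
    by rewrite !neq.
  apply/subset_leq_card/fintype.subsetP => x.
  by rewrite !inE => /orP[/orP[]|] /eqP ->; rewrite flK.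
have perpE l m : perp l m -> perp' (fl l) (fl m) by rewrite /perp' !flK => ?; apply/asboolP.
have incE P l : inc P l -> inc' (fp P) (fl l) by rewrite /inc' fpK flK => ?; apply/asboolP.
split.
- move=> P l m m' /incE Pm /incE Pm' /perpE ml /perpE m'l; apply: (can_inj flK).
  exact: (perp_unique inj' sym' irr' meet' ex' uniq' thickT Pm Pm' ml m'l).
- move=> g g' x gg' dis /perpE xg.
  suff /asboolP : perp' (fl x) (fl g') by rewrite !flK.
  apply: (disjoint_perps inj' sym' irr' meet' ex' uniq' (@subspaceT _ _ inc') _ _ _ _ _ xg);
    rewrite ?finset.in_setT //; first by apply/eqP => /(can_inj flK).
  case=> P /asboolP Pg /asboolP Pg'; apply: dis; exists (gp P).
  by rewrite !flK in Pg Pg'.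
move=> P; have pencilE : [set i | `[< lines_through P (gl i) >]] = pencil inc' (fp P).
  by apply/finset.setP => i; rewrite !inE /inc' fpK.
have := card_eq_ordinal_preimage (lines_through P) flK glK; rewrite pencilE.
exists #|pencil inc' (fp P)|; split=> //.
(* On the pencil of [P] this exchanges perpendicular lines without fixed points; the default is
   never reached. *)
pose s l := odflt l [pick m | inc' (fp P) m && perp' m l].
have sP l : inc' (fp P) (s l) && perp' (s l) l.
  rewrite /s; case: pickP => [m -> //|/= none].
  by have [m Pm ml] := ex' (fp P) l; have := none m; rewrite Pm ml.
apply: (@even_card_fpf _ _ s) => l; rewrite /pencil !finset.in_set => Pl.
have /andP[Psl sll] := sP l; have /andP[Pssl ssl] := sP (s l); split=> //.
  by apply: (uniq' _ _ _ _ Psl) => //; rewrite sym'.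
by apply: contraTneq sll => ->; rewrite irr'.
Qed.

End Finite.
End SherkPlane.

(** * Nets *)

Lemma three_elements (X : Type) (A : set X) r : (A #= `I_r)%card -> 2 < r ->
  exists a b c, [/\ A a, A b & A c] /\ [/\ a <> b, a <> c & b <> c].
Proof.
move=> /card_set_bijP[f [_ _ surj]] r2.
have [a Aa fa] := surj 0 (ltnW (ltnW r2)).
have [b Ab fb] := surj 1 (ltnW r2).
have [c Ac fc] := surj 2 r2.
by exists a, b, c; split=> //; split=> eq; congruence.
Qed.

Lemma third_element (X : Type) (A : set X) r x y : (A #= `I_r)%card -> 2 < r ->
  exists z, [/\ A z, z <> x & z <> y].
Proof.
move=> cardA r2; have [a [b [c [[Aa Ab Ac] [ab ac bc]]]]] := three_elements cardA r2.
apply: contrapT => /forallNP no.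
have xy z : A z -> z = x \/ z = y.
  by move=> Az; have [|zx] := pselect (z = x); [left|right]; apply: contrapT => zy; apply: (no z).
by case: (xy a Aa) (xy b Ab) (xy c Ac) => ? [] ? [] ?; congruence.
Qed.

Lemma fpf_involution_exists (X : Type) (A : set X) r : (A #= `I_r)%card -> ~~ odd r ->
  exists tau : X -> X,
    forall C, A C -> [/\ A (tau C), tau (tau C) = C & tau C <> C].
Proof.
move=> /card_set_bijP[f [fI f_inj surj]] evenr.
(* Exchanges [2i] and [2i + 1]; for even [r] the numbers below [r] are preserved. *)
pose swap k := if odd k then k.-1 else k.+1.
have swapK k : swap (swap k) = k.
  by rewrite /swap; case: (boolP (odd k)) => oddk; case: ifP => ?; lia.
have swap_neq k : swap k <> k by rewrite /swap; case: ifP => ?; lia.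
have swap_lt k : k < r -> swap k < r.
  by rewrite /swap; case: ifP => ? ?; lia.
have /choice[tau tauE] x : exists y, A x -> A y /\ f y = swap (f x).
  have [Ax|nAx] := pselect (A x); last by exists x.
  by have [y Ay fy] := surj _ (swap_lt _ (fI x Ax)); exists y.
exists tau => C AC; have [Atau ftau] := tauE C AC; have [Att ftt] := tauE _ Atau.
split=> // [|eqC]; last by apply: (swap_neq (f C)); rewrite -ftau eqC.
by apply: f_inj; rewrite ?ftt ?ftau ?swapK //; apply/mem_set.
Qed.

(** * From Sherk planes to nets *)

Section SherkNet.
Variable G : geometry.
Hypotheses (finG : finite_points G) (sherkG : partial_sherk_plane G).
Hypothesis thickG : has_thick_line G.

Local Notation perp := (@perp G).

Let uniqG := let: And3 u _ _ := sherk_structure sherkG finG thickG in u.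
Let disjG := let: And3 _ d _ := sherk_structure sherkG finG thickG in d.
Let cardG := let: And3 _ _ c := sherk_structure sherkG finG thickG in c.
Let symG := sherk_perp_sym sherkG.
Let exG := sherk_perp_ex sherkG.

Lemma parallel_common_perp (l m x : line G) : perp l x -> perp m x -> parallel l m.
Proof.
move=> lx mx; have [lm|lm] := pselect (l = m); [by left | right].
by case=> P [Pl Pm]; apply: lm; apply: (uniqG Pl Pm lx mx).
Qed.

Lemma perp_parallel (l m x : line G) : parallel l m -> perp x l -> perp x m.
Proof.
case=> [-> //|dis]; apply: disjG => // lm; apply: dis.
by have [P Pl] := line_has_point sherkG l; exists P; rewrite -lm.
Qed.

Lemma parallel_class_perps (l m : line G) :
  perp m l -> parallel_class m = [set n | perp n l]%classic.
Proof.
move=> ml; apply/seteqP; split=> n /=; last exact: parallel_common_perp.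
by move=> /perp_parallel mn; apply/symG/mn/symG.
Qed.

Lemma sherk_bruck_net : bruck_net G.
Proof.
have thirdP P (x y : line G) : exists z, [/\ inc P z, z <> x & z <> y].
  by have [r [_ r2 cardP]] := cardG P; apply: third_element cardP r2.
split; first exact: (sherk_partial_linear sherkG).
(* The parallel to [l] through [P] comes from two perpendiculars: [x] to [l], then [m] from [P] to
   [x]. *)
- move=> l P nPl; have [Q Ql] := line_has_point sherkG l; have [x [_ xl]] := exG Q l.
  have [m [Pm mx]] := exG P x; exists m; split.
    split=> //; case=> R [Rm Rl]; apply: nPl.
    by rewrite (uniqG Rl Rm (symG xl) mx).
  move=> m' [Pm' dis]; apply: (uniqG Pm Pm' mx); apply: symG.
  apply: (@perp_parallel l) => //; right; case=> R [Rl Rm'].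
  by apply: dis; exists R.
(* Leave [l] along its perpendiculars at two points. If the points reached agreed, the
   perpendiculars would coincide, contain [P] and [Q], and equal [l]. *)
- move=> l; have [P Pl] := line_has_point sherkG l.
  have [Q [QP Ql]] := line_has_two_points sherkG Pl.
  have off R : inc R l -> exists m R', [/\ perp m l, inc R m, inc R' m & ~ inc R' l].
    move=> Rl; have [m [Rm ml]] := exG R l.
    have [R' [R'R R'm]] := line_has_two_points sherkG Rm.
    exists m, R'; split=> // R'l; apply: (sherk_perp_irr sherkG (l := l)).
    by rewrite -{1}(sherk_partial_linear sherkG R'R R'm Rm R'l Rl).
  have [m [P' [ml Pm P'm nP'l]]] := off P Pl; have [n [Q' [nl Qn Q'n nQ'l]]] := off Q Ql.
  exists P', Q'; split=> // eqPQ; apply: (sherk_perp_irr sherkG (l := l)).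
  rewrite -eqPQ in Q'n; have mn : m = n := uniqG P'm Q'n ml nl.
  rewrite -mn in Qn.
  by rewrite -{1}(sherk_partial_linear sherkG QP Qn Pm Ql Pl).
(* Lines through another point [Q] miss [P], except the one joining them; if none joins them, any
   line serves as [h]. *)
move=> P; have [Q QP] := other_point sherkG P.
have [l0 _] := thickG.
have nthrough (h : line G) : (forall l, inc P l -> inc Q l -> l = h) ->
    exists l m : line G, [/\ l <> m, ~ inc P l & ~ inc P m].
  move=> hE; have [l [Ql lh _]] := thirdP Q h h; have [m [Qm mh ml]] := thirdP Q h l.
  by exists l, m; split=> [eq|Pl|Pm]; [apply: ml|apply: lh; apply: hE|apply: mh; apply: hE].
have [[h [Ph Qh]]|no] := pselect (exists h, inc P h /\ inc Q h).
  by apply: (nthrough h) => l Pl Ql; apply: (sherk_partial_linear sherkG QP).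
by apply: (nthrough l0) => l Pl Ql; case: no; exists l.
Qed.

(** Each class has exactly one line through [P]: if [l] is perpendicular to [x], it is the
    perpendicular from [P] to [x]. *)
Lemma parallel_classes_through (P : Defs.point G) : (@parallel_classes G #= lines_through P)%card.
Proof.
have -> : @parallel_classes G = (@parallel_class G @` lines_through P)%classic.
  apply/seteqP; split=> [_ [l _ <-]|_ [l _ <-]]; last by exists l.
  have [Q Ql] := line_has_point sherkG l; have [x [_ /symG lx]] := exG Q l.
  have [m [Pm mx]] := exG P x; exists m => //.
  by rewrite (parallel_class_perps mx) (parallel_class_perps lx).
apply: inj_card_eq => l m /set_mem Pl /set_mem Pm eqlm.
have : parallel_class l m by rewrite eqlm; left.
by case=> // -[]; exists P.
Qed.

Lemma sherk_net_perpendicularity : net_perpendicularity G.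
Proof.
(* On the class of [l] this is the set of perpendiculars to [l], again a class; no representative
   has to be chosen. *)
exists (fun C => [set m | exists2 l, C l & perp m l]%classic).
have tauE (l : line G) : [set m | exists2 n, parallel_class l n & perp m n]%classic =
    [set m | perp m l]%classic.
  apply/seteqP; split=> m /=; last by exists l => //; left.
  case=> n ln mn; apply: perp_parallel mn.
  by case: ln => [->|dis]; [left | right; case=> P [Pn Pl]; apply: dis; exists P].
split=> [C [l _ <-]|l m].
  have [Q Ql] := line_has_point sherkG l; have [m [_ ml]] := exG Q l.
  rewrite tauE -(parallel_class_perps ml) tauE (parallel_class_perps (symG ml)).
  split=> //; first exact: imageT.
  move=> /seteqP[/(_ m) irr _]; apply: (sherk_perp_irr sherkG (l := m)).
  by apply: irr; left.
rewrite tauE; split=> [lm|eqC]; first by rewrite (parallel_class_perps (symG lm)).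
apply: symG; suff : [set n | perp n l]%classic m by [].
by rewrite eqC; left.
Qed.

Lemma sherk_is_net :
  exists r, [/\ finite_net_of_degree G r, ~~ odd r, 2 < r & net_perpendicularity G].
Proof.
have [P0 _] := sherk_point sherkG; have [r [evenr r2 cardP0]] := cardG P0.
have cardC := card_eq_trans (parallel_classes_through P0) cardP0.
exists r; split=> //; last exact: sherk_net_perpendicularity.
split=> //; first exact: sherk_bruck_net.
split=> // P.
exact: card_eq_trans (card_esym (parallel_classes_through P)) cardC.
Qed.

End SherkNet.

(** * From nets to Sherk planes *)

Section Net.
Variable S : incidence_structure.
Hypothesis netS : bruck_net S.

Lemma parallel_sym (l m : line S) : parallel l m -> parallel m l.
Proof.
by case=> [->|dis]; [left | right; case=> P [Pm Pl]; apply: dis; exists P].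
Qed.

(** If [l] and [n] meet at [P], both are the parallel to [m] through [P]. *)
Lemma net_parallel_trans (l m n : line S) : parallel l m -> parallel m n -> parallel l n.
Proof.
case: netS => _ N1 _ _ [-> //|lm] [<-|mn]; first by right.
have [ln|ln] := pselect (l = n); [by left | right; case=> P [Pl Pn]].
have nPm : ~ inc P m by move=> Pm; apply: lm; exists P.
have [k [_ kE]] := N1 m P nPm; apply: ln; rewrite -(kE l) // -(kE n) //.
by split=> //; case=> Q [Qn Qm]; apply: mn; exists Q.
Qed.

Lemma net_parallel_classP (l m : line S) :
  parallel_class l = parallel_class m <-> parallel l m.
Proof.
split=> [eqlm|lm]; first by change (parallel_class l m); rewrite eqlm; left.
apply/seteqP; split=> n; last exact: net_parallel_trans.
by apply: net_parallel_trans; apply: parallel_sym.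
Qed.

Lemma net_parallel_ex P (l : line S) :
  exists m, inc P m /\ parallel_class m = parallel_class l.
Proof.
case: netS => _ N1 _ _; have [Pl|nPl] := pselect (inc P l); first by exists l.
by have [m [[Pm dis] _]] := N1 l P nPl; exists m; split; rewrite // net_parallel_classP; right.
Qed.

Lemma net_parallel_uniq P (l m : line S) : inc P l -> inc P m ->
  parallel_class l = parallel_class m -> l = m.
Proof. by move=> Pl Pm /net_parallel_classP[//|[]]; exists P. Qed.

End Net.

(** Since [tau] fixes no class, perpendicular lines are not parallel and so meet; the perpendicular
    from a point is its line in the paired class. *)
Lemma net_is_sherk (G : geometry) r : finite_net_of_degree G r -> 2 < r ->
  net_perpendicularity G -> finite_sherk_with_thick_line G.
Proof.
move=> [finG netG [cardP cardC]] r2 [tau [tauP perpE]].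
have tauC (l : line G) : exists m : line G, [/\ tau (parallel_class l) = parallel_class m,
    tau (parallel_class m) = parallel_class l & parallel_class m <> parallel_class l].
  have [|[m _ eqm] tt neq] := tauP (parallel_class l); first exact: imageT.
  by exists m; rewrite eqm.
have perp_sym (l m : line G) : perp l m -> perp m l.
  move=> /perpE lm; apply/perpE; have [n [ln nl _]] := tauC l.
  by rewrite -lm ln nl.
have perp_meet (l m : line G) : perp l m -> intersect l m.
  move=> /perpE lm; apply: contrapT => dis; have [n [ln _ nl]] := tauC l.
  by apply: nl; rewrite -ln lm; apply/esym/net_parallel_classP => //; right.
have perp_ex P (l : line G) : exists m, inc P m /\ perp m l.
  have [n [ln nl _]] := tauC l; have [m [Pm mn]] := net_parallel_ex netG P n.
  by exists m; split=> //; apply/perpE; rewrite mn.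
have perp_uniq P (l m m' : line G) :
    inc P m -> inc P m' -> perp m l -> perp m' l -> m = m'.
  move=> Pm Pm' /perp_sym/perpE lm /perp_sym/perpE lm'.
  by apply: (net_parallel_uniq netG Pm Pm'); rewrite -lm.
have [_ [_ [_ [[[l0 _ _] _ _] _]]]] := three_elements cardC r2.
split=> //; last first.
  exists l0 => P _; have [l [m [n [[Pl Pm Pn] neq]]]] := three_elements (cardP P) r2.
  by exists l, m, n.
split; first by case: netG.
split=> //.
  move=> P l _; have [m [Pm ml]] := perp_ex P l; exists m; split=> // m' [Pm' m'l].
  exact: (perp_uniq P l).
(* Witnesses for the last axiom: [l0], a line [m] of the paired class, and [z] of a third class,
   moved within that class if necessary to avoid the point [P] on [l0] and [m]. *)
have [m [lm ml _]] := tauC l0.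
have l0m : perp l0 m by apply/perpE.
have [P [Pl0 Pm]] := perp_meet _ _ l0m.
have [_ [[z0 _ <-] zl zm]] :=
  third_element (parallel_class l0) (parallel_class m) cardC r2.
have [z [zz0 nPz]] : exists z, parallel_class z = parallel_class z0 /\ ~ inc P z.
  have [Pz0|] := pselect (inc P z0); last by exists z0.
  have [_ _ N2 _] := netG; have [Q [_ [_ nQz0 _]]] := N2 z0.
  have [z [Qz zz0]] := net_parallel_ex netG Q z0; exists z; split=> // Pz.
  by apply: nQz0; rewrite -(net_parallel_uniq netG Pz Pz0 zz0).
exists l0, m, z; split=> //.
- by move/perpE; rewrite lm zz0 => /esym.
- by move/perpE; rewrite ml zz0 => /esym.
case=> Q [Ql0 Qm Qz]; apply: nPz; have [->//|QP] := pselect (P = Q).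
have [+ _ _ _] := netG => plG; have eqlm := plG _ _ _ _ QP Pl0 Ql0 Pm Qm.
by have [n [ln _ []]] := tauC l0; rewrite -ln lm eqlm.
Qed.

Theorem theorem1p1 :
  (forall G : geometry,
     finite_sherk_with_thick_line G <->
     exists r : nat,
       [/\ finite_net_of_degree G r, ~~ odd r, 2 < r & net_perpendicularity G])
  /\
  (forall S : incidence_structure,
     (exists p : line S -> line S -> Prop,
        finite_sherk_with_thick_line (Geometry p)) <->
     exists r : nat, [/\ finite_net_of_degree S r, ~~ odd r & 2 < r]).
Proof.
split=> [G|S]; split.
- by case=> finG sherkG thickG; apply: sherk_is_net.
- by case=> r [netG _ r2 perpG]; apply: net_is_sherk netG r2 perpG.
- by case=> p [finG sherkG thickG]; have [r []] := sherk_is_net finG sherkG thickG; exists r.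
case=> r [netS evenr r2]; have [_ _ [_ cardC]] := netS.
have [tau tauP] := fpf_involution_exists cardC evenr.
exists (fun l m => tau (parallel_class l) = parallel_class m).
by apply: (@net_is_sherk (Geometry _) r) => //; exists tau.
Qed.
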